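(* Let $c$ be a real number with $c < \frac{3}{2}$. Then there exists a positive integer $K$ such that, for every integer $k \geq K$, it is not possible to visit all the points of $P(3,k)$ with a polygonal chain of link-length at most $\frac{k}{k-1} \cdot 3^{k-1} + c \cdot 3^{k-2}$; that is, $h(3,k) > \frac{k}{k-1} \cdot 3^{k-1} + c \cdot 3^{k-2}$ for every $k \geq K$.
   Context: For positive integers $n, k$, let $P(n,k) := \{0,1,\dots,n-1\}^k$, a set of $n^k$ points in $\mathbb{R}^k$. A covering trail for a finite set $S \subset \mathbb{R}^k$ is a polygonal chain in $\mathbb{R}^k$ (a sequence of straight line segments, called edges or links, each consecutive pair sharing an endpoint: $V_0V_1, V_1V_2, \dots, V_{m-1}V_m$ with $V_j \in \mathbb{R}^k$) whose union contains every point of $S$. The vertices $V_j$ are arbitrary points of $\mathbb{R}^k$ (not necessarily points of $S$), the edges need not be axis-parallel, and points of $S$ may be visited more than once. The link-length of the chain is its number $m$ of edges. $h(n,k)$ denotes the minimum link-length of a covering trail for $P(n,k)$. *)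

(* Defs.v *)
From mathcomp Require Import all_boot all_order all_algebra.
From mathcomp Require Import boolp classical_sets set_interval reals.

Set Implicit Arguments.
Unset Strict Implicit.
Unset Printing Implicit Defensive.

Import Order.TTheory GRing.Theory Num.Theory.
Local Open Scope classical_set_scope.
Local Open Scope ring_scope.

Definition grid (R : realType) (n k : nat) : set 'rV[R]_k :=
  [set x : 'rV[R]_k | forall i : 'I_k,
    exists2 a : nat, (a < n)%N & x 0 i = a%:R].
Arguments grid R n k : clear implicits.

Definition segment (R : realType) (k : nat) (a b : 'rV[R]_k) : set 'rV[R]_k :=
  [set (1 - t) *: a + t *: b | t in `[0, 1]%classic].

(* A polygonal chain with m edges is its vertex family V_0, ..., V_m; edge j
   joins V_j (widen_ord) to V_(j+1) (lift ord0).  Degenerate edges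
   V_j = V_(j+1) are allowed. *)
Definition chain_support (R : realType) (k m : nat)
    (V : 'I_m.+1 -> 'rV[R]_k) : set 'rV[R]_k :=
  \bigcup_(j in [set: 'I_m])
    segment (V (widen_ord (leqnSn m) j)) (V (lift ord0 j)).

Definition covering_trail (R : realType) (k : nat) (S : set 'rV[R]_k)
    (m : nat) (V : 'I_m.+1 -> 'rV[R]_k) : Prop :=
  S `<=` chain_support V.

Definition has_covering_trail (R : realType) (k : nat) (S : set 'rV[R]_k)
    (m : nat) : Prop :=
  exists V : 'I_m.+1 -> 'rV[R]_k, covering_trail S V.

(* Joining the points of the grid one after the other gives a covering trail. *)
Lemma grid_has_covering_trail (R : realType) (n k : nat) :
  exists m : nat, `[< has_covering_trail (grid R n k) m >].
Proof.
pose pt (f : {ffun 'I_k -> 'I_n}) : 'rV[R]_k := \row_i (f i : nat)%:R.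
pose s := map pt (enum {ffun 'I_k -> 'I_n}).
exists (size s); apply/asboolP; exists (fun j => nth 0 s j) => x xP.
have xs : x \in s.
  have xP' (i : 'I_k) : {a : 'I_n | x 0 i = (a : nat)%:R}.
    apply: cid; case: (xP i) => a an ->.
    by exists (Ordinal an).
  apply/mapP; exists [ffun i => sval (xP' i)]; first by rewrite mem_enum.
  by apply/rowP => i; rewrite mxE ffunE; case: (xP' i).
have lt_xs : (index x s < size s)%N by rewrite index_mem.
exists (Ordinal lt_xs) => //; exists 0.
  by rewrite /= in_itv /= lexx ler01.
by rewrite subr0 scale1r scale0r addr0 /= nth_index.
Qed.

(* h(n, k): ex_minn returns the least m satisfying the predicate. *)
Definition min_link_length (R : realType) (n k : nat) : nat :=
  ex_minn (grid_has_covering_trail R n k).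

(* Main.v *)
Require Import Defs.
From mathcomp Require Import all_boot all_order all_algebra.
From mathcomp Require Import boolp classical_sets set_interval reals.
From mathcomp Require Import ring lra zify.

Import Order.TTheory GRing.Theory Num.Theory.
Local Open Scope ring_scope.

(* Identify the grid {0, 1, 2}^k with F_3^k.  The grid points on an edge that
   contains at least two of them lie on a line of F_3^k.  For two consecutive
   such edges these lines meet: the common vertex is w + a (w - u) =
   w' + b (w' - u') with grid points u, w, u', w' and real a, b >= 0, and each
   coordinate that actually involves a or b expresses one of a short list of
   affine relations between them.  All the relations that hold for given
   a, b >= 0 have a common solution in F_3, which yields a point on both lines.
   So an edge adds at most two new points to the union of the lines, except
   after an edge with at most one grid point, where it may add three, but then
   the previous edge added at most one.  Hence a covering trail with m edges
   satisfies 3^k <= 2 m + 1. *)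

(** * Arithmetic of a single coordinate modulo 3 *)

(* These are the relations that an equation w + a (w - u) = w' + b (w' - u')
   with u, w, u', w' in {0, 1, 2} can express when 0 <= a <= b. *)
Definition reduces_to {R : realFieldType} (a b : R) (x y : 'F_3) : Prop :=
  [/\ [/\ a = 0 -> x = 0, a = 1 -> x = 1, b = 0 -> y = 0 & b = 1 -> y = 1],
      b = a -> y = x, b = a + 1 -> y = x + 1, b = a *+ 2 -> y = x *+ 2
    & b = a *+ 2 + 1 -> y = x *+ 2 + 1].

Local Ltac check_values := split; first split; move=> ?;
  first [exact: val_inj | exfalso; lra
        | by match goal with n : ?e <> _ |- _ => case: n; lra end].

Lemma reduces_to_exists (R : realFieldType) (a b : R) :
  0 <= a -> a <= b -> exists x y, reduces_to a b x y.
Proof.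
move=> a_ge0 le_ab.
have [a0|a0] := pselect (a = 0); have [b1|b1] := pselect (b = 1).
- by exists 0, 1; check_values.
- by exists 0, 0; check_values.
- have [a1|a1] := pselect (a = 1); [exists 1, 1 | exists (- 1), 1]; check_values.
have [a1|a1] := pselect (a = 1).
  have [b2|b2] := pselect (b = 2); first by exists 1, (- 1); check_values.
  by exists 1, 0; check_values.
have [ba1|ba1] := pselect (b = a + 1); first by exists 0, 1; check_values.
have [ba2|ba2] := pselect (b = a *+ 2 + 1); first by exists 0, 1; check_values.
by exists 0, 0; check_values.
Qed.

Lemma reduces_to_eq (R : realFieldType) (a b : R) (x y : 'F_3)
    (u w u' w' : nat) :
  0 <= a -> a <= b -> reduces_to a b x y ->
  (u < 3)%N -> (w < 3)%N -> (u' < 3)%N -> (w' < 3)%N ->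
  w%:R + a * (w%:R - u%:R) = w'%:R + b * (w'%:R - u'%:R) ->
  w%:R + x * (w%:R - u%:R) = w'%:R + y * (w'%:R - u'%:R).
Proof.
move=> a_ge0 le_ab [[xa0 xa1 yb0 yb1] e1 e2 e3 e4].
case: u => [|[|[|//]]] _; case: w => [|[|[|//]]] _;
  case: u' => [|[|[|//]]] _; case: w' => [|[|[|//]]] _ E.
(* At fixed grid values the equation is impossible for [0 <= a <= b], or trivial, or forces premises
   of [reduces_to] that fix [x] or [y]. *)
all: try by (exfalso; clear -a_ge0 le_ab E; lra).
all: try (rewrite xa0; last by clear -a_ge0 le_ab E; lra).
all: try (rewrite xa1; last by clear -a_ge0 le_ab E; lra).
all: try (rewrite yb0; last by clear -a_ge0 le_ab E; lra).
all: try (rewrite yb1; last by clear -a_ge0 le_ab E; lra).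
all: try (rewrite e1; last by clear -a_ge0 le_ab E; lra).
all: try (rewrite e2; last by clear -a_ge0 le_ab E; lra).
all: try (rewrite e3; last by clear -a_ge0 le_ab E; lra).
all: try (rewrite e4; last by clear -a_ge0 le_ab E; lra).
all: clear.
all: repeat match goal with z : 'F_3 |- _ => case: z => [[|[|[|//]]]] ? end.
all: exact: val_inj.
Qed.

Lemma collinear_eq (R : realFieldType) (s : R) :
  exists x : 'F_3, forall u w p : nat,
    (u < 3)%N -> (w < 3)%N -> (p < 3)%N ->
    p%:R = w%:R + s * (w%:R - u%:R) -> p%:R = w%:R + x * (w%:R - u%:R).
Proof.
(* When [u <> w], the other possible ratios are 1, -2 and -1/2, all equal to 1 modulo 3. *)
have [s0|s0] := pselect (s = 0); [exists 0|];
  last (have [s1|s1] := pselect (s = - 1); [exists (- 1)|exists 1]).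
all: case=> [|[|[|//]]] [|[|[|//]]] [|[|[|//]]] _ _ _ E.
all: first [exact: val_inj | exfalso; lra | case: s0; lra | case: s1; lra].
Qed.

(* - (x + y) is the third point of the line of F_3^k through x and y, and is x
   itself when y = x. *)
Definition span3 {T : finZmodType} (S : {set T}) : {set T} :=
  [set - (x + y) | x in S, y in S].

Definition grid_point {R : realType} {k : nat} (g : 'rV['F_3]_k) : 'rV[R]_k :=
  map_mx (fun z : 'F_3 => (z : nat)%:R) g.

Lemma val_F3K (z : 'F_3) : (z : nat)%:R = z.
Proof. exact: (natr_Zp (z : 'Z_3)). Qed.

(** * Grid points on an edge *)

Section Grid.
Context {R : realType} {k : nat}.
Implicit Types (A B C : 'rV[R]_k) (u w p q : 'rV['F_3]_k).
Notation pt := (@grid_point R k).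

Lemma grid_point_inj : injective pt.
Proof.
move=> u w /rowP uw; apply/rowP => i; move: (uw i); rewrite !mxE.
by move/eqP; rewrite eqr_nat => /eqP /val_inj.
Qed.

Lemma grid_collinear u w p (s : R) :
  pt p = pt w + s *: (pt w - pt u) -> exists x, p = w + x *: (w - u).
Proof.
move=> /rowP puw; have [x xP] := collinear_eq _ s; exists x; apply/rowP => i.
rewrite !mxE -[p 0 i]val_F3K -[w 0 i]val_F3K -[u 0 i]val_F3K.
by apply: xP; rewrite ?(ltn_ord (_ : 'F_3)) //; move: (puw i); rewrite !mxE.
Qed.

(** [reduces_to] involves only [a] and [b], so one pair [x], [y] serves all coordinates. *)
Lemma grid_rays_meet u w u' w' (a b : R) : 0 <= a -> 0 <= b ->
  pt w + a *: (pt w - pt u) = pt w' + b *: (pt w' - pt u') ->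
  exists x y, w + x *: (w - u) = w' + y *: (w' - u').
Proof.
wlog le_ab : u w u' w' a b / a <= b => [th|] a_ge0 b_ge0 /rowP meet.
  case/orP: (le_total a b) => [/th|/th]; first by apply=> //; apply/rowP.
  case/(_ u' w' u w) => //; first by apply/rowP => i; rewrite meet.
  by move=> x [y e]; exists y, x.
have [x [y xyP]] := reduces_to_exists _ _ _ a_ge0 le_ab; exists x, y.
apply/rowP => i; rewrite !mxE -[w 0 i]val_F3K -[u 0 i]val_F3K.
rewrite -[w' 0 i]val_F3K -[u' 0 i]val_F3K.
apply: (reduces_to_eq _ _ _ _ _ _ _ _ _ a_ge0 le_ab xyP);
  rewrite ?(ltn_ord (_ : 'F_3)) //.
by move: (meet i); rewrite !mxE.
Qed.

Lemma segmentP A B C :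
  segment A B C -> exists t, [/\ 0 <= t, t <= 1 & C = A + t *: (B - A)].
Proof.
case=> t /=; rewrite in_itv /= => /andP[t0 t1] <-; exists t; split => //.
by apply/rowP => i; rewrite !mxE; ring.
Qed.

Lemma segment_sym A B C : segment A B C -> segment B A C.
Proof.
case=> t /=; rewrite in_itv /= => /andP[t0 t1] <-; exists (1 - t).
  by rewrite /= in_itv /=; apply/andP; split; lra.
by rewrite subKr addrC.
Qed.

Definition trace A B : {set 'rV['F_3]_k} :=
  [set g | `[< segment A B (pt g) >]].

Lemma traceP A B g : reflect (segment A B (pt g)) (g \in trace A B).
Proof. by rewrite inE; apply: asboolP. Qed.

Lemma trace_sym A B : trace A B = trace B A.
Proof. by apply/setP => g; apply/traceP/traceP => /segment_sym. Qed.

Lemma trace_end A B : (1 < #|trace A B|)%N ->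
  exists u w a, [/\ u \in trace A B, w \in trace A B, 0 <= a
    & B = pt w + a *: (pt w - pt u)].
Proof.
case/card_gt1P => u [w [uAB wAB neq_uw]].
have /segmentP[t [t0 t1 ut]] := traceP _ _ _ uAB.
have /segmentP[r [r0 r1 wr]] := traceP _ _ _ wAB.
wlog lt_tr : u w t r uAB wAB neq_uw t0 t1 ut r0 r1 wr / t < r => [th|].
  have [tr|rt|eq_tr] := ltgtP t r; first exact: (th u w t r).
    by apply: (th w u r t) => //; rewrite eq_sym.
  by case/eqP: neq_uw; apply: grid_point_inj; rewrite ut wr eq_tr.
(* Here [w - u] is [r - t] times [B - A], and [B - w] is [1 - r] times it. *)
exists u, w, ((1 - r) / (r - t)); split => //.
  by apply: divr_ge0; lra.
rewrite ut wr; apply/rowP => i; rewrite !mxE; field.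
by rewrite subr_eq0 gt_eqF.
Qed.

Lemma trace_line A B u w : u \in trace A B -> w \in trace A B -> u != w ->
  forall p, p \in trace A B -> exists x, p = w + x *: (w - u).
Proof.
move=> /traceP/segmentP[t [_ _ ut]] /traceP/segmentP[r [_ _ wr]] neq_uw p.
move=> /traceP/segmentP[s [_ _ ps]].
apply: (@grid_collinear _ _ _ ((s - r) / (r - t))).
rewrite ps ut wr; apply/rowP => i; rewrite !mxE; field.
rewrite subr_eq0; apply: contra_neq neq_uw => eq_rt.
by apply: grid_point_inj; rewrite ut wr eq_rt.
Qed.

End Grid.

(** * Lines of F_3^k attached to edges *)

Lemma sub_span3 k (S : {set 'rV['F_3]_k}) : S \subset span3 S.
Proof.
apply/fintype.subsetP => g gS; apply/imset2P; exists g g => //.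
by apply/rowP => i; rewrite !mxE; case: (g 0 i) => [[|[|[|//]]]] ?; exact: val_inj.
Qed.

Lemma mem_span3_line k (S : {set 'rV['F_3]_k}) u w (x : 'F_3) :
  u \in S -> w \in S -> w + x *: (w - u) \in span3 S.
Proof.
(* The scalars 0, 1, 2 give [w], the third point and [u]. *)
move=> uS wS; apply/imset2P; case: x => [[|[|[|//]]]] x3;
  [exists w w | exists u w | exists u u] => //; apply/rowP => i; rewrite !mxE;
  by case: (w 0 i) => [[|[|[|//]]]] ?; case: (u 0 i) => [[|[|[|//]]]] ?;
     exact: val_inj.
Qed.

Lemma card_span3_le1 k (S : {set 'rV['F_3]_k}) :
  (#|S| <= 1)%N -> (#|span3 S| <= 1)%N.
Proof.
move/card_le1_eqP => eqS; apply/card_le1_eqP.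
move=> _ _ /imset2P[p q pS qS ->] /imset2P[u w uS wS ->].
by rewrite (eqS p u) // (eqS q w).
Qed.

Lemma card_span3_trace (R : realType) k (A B : 'rV[R]_k) :
  (#|span3 (trace A B)| <= 3)%N.
Proof.
have [le1|/card_gt1P[u [w [uAB wAB neq_uw]]]] := leqP #|trace A B| 1.
  exact: leq_trans (card_span3_le1 _ _ le1) _.
have line := trace_line _ _ _ _ uAB wAB neq_uw.
have line3 : (#|[set (w + x *: (w - u))%R | x in [set: 'F_3]%SET]| <= 3)%N.
  by apply: leq_trans (leq_imset_card _ _) _; rewrite cardsT card_Fp.
apply: leq_trans line3; apply/subset_leq_card/fintype.subsetP.
move=> _ /imset2P[p q /line[x ->] /line[y ->] ->].
apply/imsetP; exists (- (x + y)) => //; apply/rowP => i; rewrite !mxE.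
have w3 : w 0 i *+ 3 = 0.
  by case: (w 0 i) => [[|[|[|//]]]] ?; exact: val_inj.
by rewrite -[RHS]subr0 -w3; ring.
Qed.

(** The shared vertex [B] ends both edges once the second is reversed, so it lies on a ray through
    two grid points of each. *)
Lemma span3_traces_meet (R : realType) k (A B C : 'rV[R]_k) :
  (1 < #|trace A B|)%N -> (1 < #|trace B C|)%N ->
  span3 (trace A B) :&: span3 (trace B C) != finset.set0.
Proof.
move=> /trace_end[u [w [a [uS wS a0 eB]]]].
rewrite [trace B C]trace_sym => /trace_end[u' [w' [b [uS' wS' b0 eB']]]].
have [x [y xy]] := grid_rays_meet _ _ _ _ _ _ a0 b0 (etrans (esym eB) eB').
apply/set0Pn; exists (w + x *: (w - u)).
by rewrite inE {2}xy !mem_span3_line.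
Qed.

(** * Counting points edge by edge *)

Lemma card_linked_cover (T : finType) (E : nat -> {set T}) (m : nat) :
  (forall j, #|E j| <= 3)%N ->
  (forall j, (1 < #|E j|)%N -> (1 < #|E j.+1|)%N -> E j :&: E j.+1 != finset.set0) ->
  (#|\bigcup_(j < m) E j| <= m.*2.+1)%N.
Proof.
move=> E3 meet.
(* A set with at most one point pays for the three new points of the next. *)
suff [] : (#|\bigcup_(j < m) E j| <= m.*2.+1)%N /\
  ((0 < m)%N -> (#|E m.-1| <= 1)%N -> (#|\bigcup_(j < m) E j| <= m.*2)%N) by [].
elim: m => [|m [IH1 IH2]]; first by rewrite big_ord0 cards0.
rewrite big_ord_recr /= cardsU.
set U := \bigcup_(j < m) E j in IH1 IH2 *; move: (E3 m).
have [Em _|Em] := leqP #|E m| 1.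
  by split=> *; lia.
move=> Em3; split=> [|_ //].
(* The first set has no predecessor and may add three points; this is the extra 1 in the bound. *)
case: m @U IH1 IH2 Em Em3 => [|m] U IH1 IH2 Em Em3.
  by rewrite /U big_ord0 cards0 add0n; lia.
have [Em'|Em'] := leqP #|E m| 1; first by move: (IH2 isT Em'); lia.
have /set0Pn[x /setIP[xm xm1]] := meet m Em' Em.
have : (0 < #|U :&: E m.+1|)%N.
  apply/card_gt0P; exists x; rewrite inE xm1 andbT.
  by apply/bigcupP; exists ord_max.
by lia.
Qed.

Lemma covering_trail_length (R : realType) (k m : nat) (V : 'I_m.+1 -> 'rV[R]_k) :
  covering_trail (grid R 3 k) V -> (3 ^ k <= m.*2.+1)%N.
Proof.
(* [S] is total on [nat]; [inord] gives a default vertex beyond [m], harmless since the union stops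
   at [m]. *)
move=> cov; pose S j := trace (V (inord j)) (V (inord j.+1)).
have <- : #|\bigcup_(j < m) span3 (S j)| = (3 ^ k)%N.
  transitivity #|[set: 'rV['F_3]_k]%SET|; last by rewrite cardsT card_mx card_Fp ?mul1n.
  congr #|pred_of_set _|; apply/eqP; rewrite finset.eqEsubset finset.subsetT.
  apply/fintype.subsetP => g _.
  have /cov[j _ gj] : grid R 3 k (grid_point g).
    by move=> i; exists (g 0 i); [exact: (ltn_ord (g 0 i)) | rewrite mxE].
  apply/bigcupP; exists j => //; apply: (fintype.subsetP (sub_span3 _ _)).
  apply/traceP; congr (segment (V _) (V _) _): gj; apply: val_inj => /=.
    by rewrite inordK // ltnS ltnW.
  by rewrite inordK // ltnS.
apply: (card_linked_cover _ (fun j => span3 (S j))) => j; first exact: card_span3_trace.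
move=> E1 E2; apply: span3_traces_meet; rewrite ltnNge; apply/negP.
  by move/card_span3_le1; rewrite leqNgt E1.
by move/card_span3_le1; rewrite leqNgt E2.
Qed.

Theorem mainTheorem2 (R : realType) (c : R) (hc : c < 3 / 2) :
  exists2 K : nat, (0 < K)%N &
    forall k : nat, (K <= k)%N ->
      (forall (m : nat) (V : 'I_m.+1 -> 'rV[R]_k),
         m%:R <= k%:R / (k%:R - 1) * 3 ^+ (k - 1) + c * 3 ^+ (k - 2) ->
         ~ covering_trail (grid R 3 k) V) /\
      k%:R / (k%:R - 1) * 3 ^+ (k - 1) + c * 3 ^+ (k - 2)
        < (min_link_length R 3 k)%:R.
Proof.
have d_gt0 : 0 < 3 - 2 * c by lra.
(* With [q = 3 ^+ (k - 2)] and [r = q / (k - 1)], the bound [9 * q <= 2 * m + 1] suffices if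
   [6 * r + 1 < (3 - 2 * c) * q]. As [1 <= r], it is enough that [7 < (3 - 2 * c) * (k - 1)]. *)
exists (Num.truncn (7 / (3 - 2 * c))).+2 => // k.
case: k => [|[|k]] // /ltnSE/ltnSE leKk.
rewrite subn1 subn2 /=.
have bound (m : nat) : (3 ^ k.+2 <= m.*2.+1)%N ->
  k.+2%:R / (k.+2%:R - 1) * 3 ^+ k.+1 + c * 3 ^+ k < m%:R :> R.
  rewrite -(ler_nat R) natrX -[m.*2.+1]addn1 natrD -muln2 natrM !exprS => le3.
  have k7 : 7 < (3 - 2 * c) * (k%:R + 1).
    rewrite mulrC -ltr_pdivrMr // natr1.
    by apply: lt_le_trans (truncnS_gt _) _; rewrite ler_nat ltnS.
  have k3 : k%:R + 1 <= 3 ^+ k :> R.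
    by rewrite natr1 -natrX ler_nat ltn_expl.
  have -> : k.+2%:R = k%:R + 2 :> R by rewrite -addn2 natrD.
  have k0 : 0 <= k%:R :> R by [].
  set x : R := k%:R in k7 k3 k0 *; set q : R := 3 ^+ k in le3 k3 *.
  have -> : (x + 2) / (x + 2 - 1) * (3 * q) + c * q =
            3 * q + 3 * (q / (x + 1)) + c * q by field; lra.
  set r := q / (x + 1).
  have qr : q = r * (x + 1) by rewrite /r; field; lra.
  have r1 : 1 <= r by rewrite /r ler_pdivlMr; lra.
  clearbody r.
  have : 7 * r < (3 - 2 * c) * q by rewrite qr mulrCA [7 * r]mulrC ltr_pM2l //; lra.
  by lra.
split=> [m V le_m /covering_trail_length/bound|]; first by rewrite ltNge le_m.
rewrite /min_link_length; case: ex_minnP => m /asboolP[V covV] _.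
exact: bound (covering_trail_length _ _ _ _ covV).
Qed.
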